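(* ${\bf ITL}^{\bf FS}$ is sound for the class of open dynamical systems.
   Context: Formulas of $\mathcal L$ are built from propositional variables and $\bot$ by $\wedge,\vee,\to,\circ,\Diamond,\Box$. ${\bf ITL}^0$ is axiomatized by all intuitionistic tautologies, $\neg\circ\bot$, $\circ(\varphi\wedge\psi)\leftrightarrow(\circ\varphi\wedge\circ\psi)$, $\circ(\varphi\vee\psi)\leftrightarrow(\circ\varphi\vee\circ\psi)$, $\circ(\varphi\to\psi)\to(\circ\varphi\to\circ\psi)$, $\Box(\varphi\to\psi)\to(\Box\varphi\to\Box\psi)$, $\Box(\varphi\to\psi)\to(\Diamond\varphi\to\Diamond\psi)$, $\Diamond(\varphi\vee\psi)\to(\Diamond\varphi\vee\Diamond\psi)$, $\Box\varphi\to\varphi\wedge\circ\Box\varphi$, $\varphi\vee\circ\Diamond\varphi\to\Diamond\varphi$, with rules: from $\varphi\to\circ\varphi$ infer $\varphi\to\Box\varphi$; from $\circ\varphi\to\varphi$ infer $\Diamond\varphi\to\varphi$; modus ponens; from $\varphi$ infer $\circ\varphi$. ${\bf ITL}^{\bf FS}={\bf ITL}^0+{\rm FS}_\circ+{\rm FS}_\Diamond$, where ${\rm FS}_\circ(\varphi,\psi)$ is $(\circ\varphi\to\circ\psi)\to\circ(\varphi\to\psi)$ and ${\rm FS}_\Diamond(\varphi,\psi)$ is $(\Diamond\varphi\to\Box\psi)\to\Box(\varphi\to\psi)$. A dynamical system $(X,\mathcal T,S)$ is a topological space with continuous $S\colon X\to X$; it is open if $S$ is moreover an open map (images of open sets are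 open). Valuations $[\![\cdot]\!]$ map formulas to open sets: $[\![\bot]\!]=\varnothing$, $\cap$ for $\wedge$, $\cup$ for $\vee$, $[\![\varphi\to\psi]\!]=((X\setminus[\![\varphi]\!])\cup[\![\psi]\!])^\circ$, $[\![\circ\varphi]\!]=S^{-1}[\![\varphi]\!]$, $[\![\Diamond\varphi]\!]=\bigcup_{n\ge0}S^{-n}[\![\varphi]\!]$, $[\![\Box\varphi]\!]=\bigcup\{U\in\mathcal T:S[U]\subseteq U\subseteq[\![\varphi]\!]\}$. Soundness for a class means every derivable formula has $[\![\varphi]\!]=X$ for every valuation on every system in the class. *)

(* Defs.v *)
From Stdlib Require List.
From mathcomp Require Import all_boot.
From mathcomp Require Import all_classical topology.

Set Implicit Arguments.
Unset Strict Implicit.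
Unset Printing Implicit Defensive.

Local Open Scope classical_set_scope.

Inductive form (V : Type) : Type :=
| Var of V
| Bot
| And of form V & form V
| Or of form V & form V
| Imp of form V & form V
| Next of form V
| Dia of form V
| Box of form V.

Arguments Bot {V}.

Declare Scope itl_scope.
Delimit Scope itl_scope with itl.
Bind Scope itl_scope with form.

Notation "⊥" := Bot : itl_scope.
Notation "p ∧ q" := (And p q) (at level 80, right associativity) : itl_scope.
Notation "p ∨ q" := (Or p q) (at level 85, right associativity) : itl_scope.
Notation "p ⇒ q" := (Imp p q) (at level 89, right associativity) : itl_scope.
Notation "p ⇔ q" := (And (Imp p q) (Imp q p)) (at level 90) : itl_scope.
Notation "¬ p" := (Imp p Bot) (at level 35, right associativity) : itl_scope.
Notation "◯ p" := (Next p) (at level 35, right associativity) : itl_scope.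
Notation "◇ p" := (Dia p) (at level 35, right associativity) : itl_scope.
Notation "□ p" := (Box p) (at level 35, right associativity) : itl_scope.

(* Intuitionistic tautologies are the purely propositional formulas provable
   by natural deduction (NJ); a tautology of the temporal language is a
   substitution instance of one of them. *)
Inductive pform : Type :=
| PVar of nat
| PBot
| PAnd of pform & pform
| POr of pform & pform
| PImp of pform & pform.

Inductive NJ : seq pform -> pform -> Prop :=
| NJ_hyp G p : List.In p G -> NJ G p
| NJ_botE G p : NJ G PBot -> NJ G p
| NJ_andI G p q : NJ G p -> NJ G q -> NJ G (PAnd p q)
| NJ_andEl G p q : NJ G (PAnd p q) -> NJ G p
| NJ_andEr G p q : NJ G (PAnd p q) -> NJ G q
| NJ_orIl G p q : NJ G p -> NJ G (POr p q)
| NJ_orIr G p q : NJ G q -> NJ G (POr p q)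
| NJ_orE G p q r :
    NJ G (POr p q) -> NJ (p :: G) r -> NJ (q :: G) r -> NJ G r
| NJ_impI G p q : NJ (p :: G) q -> NJ G (PImp p q)
| NJ_impE G p q : NJ G (PImp p q) -> NJ G p -> NJ G q.

Fixpoint psubst (V : Type) (s : nat -> form V) (p : pform) : form V :=
  match p with
  | PVar i => s i
  | PBot => Bot
  | PAnd p q => And (psubst s p) (psubst s q)
  | POr p q => Or (psubst s p) (psubst s q)
  | PImp p q => Imp (psubst s p) (psubst s q)
  end.

Definition intuitionistic_tautology (V : Type) (a : form V) : Prop :=
  exists p s, NJ [::] p /\ a = psubst s p.

Inductive ITL0_axiom (V : Type) : form V -> Prop :=
| ax_taut a : intuitionistic_tautology a -> ITL0_axiom a
| ax_next_bot : ITL0_axiom (¬ ◯ ⊥)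
| ax_next_and a b : ITL0_axiom (◯ (a ∧ b) ⇔ (◯ a ∧ ◯ b))
| ax_next_or a b : ITL0_axiom (◯ (a ∨ b) ⇔ (◯ a ∨ ◯ b))
| ax_next_imp a b : ITL0_axiom (◯ (a ⇒ b) ⇒ (◯ a ⇒ ◯ b))
| ax_box_imp a b : ITL0_axiom (□ (a ⇒ b) ⇒ (□ a ⇒ □ b))
| ax_dia_imp a b : ITL0_axiom (□ (a ⇒ b) ⇒ (◇ a ⇒ ◇ b))
| ax_dia_or a b : ITL0_axiom (◇ (a ∨ b) ⇒ (◇ a ∨ ◇ b))
| ax_box_fix a : ITL0_axiom (□ a ⇒ (a ∧ ◯ □ a))
| ax_dia_fix a : ITL0_axiom ((a ∨ ◯ ◇ a) ⇒ ◇ a).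

(* [ITL0_plus A a]: [a] is derivable in ITL^0 extended with the axioms [A]. *)
Inductive ITL0_plus (V : Type) (A : form V -> Prop) : form V -> Prop :=
| der_ITL0 a : ITL0_axiom a -> ITL0_plus A a
| der_extra a : A a -> ITL0_plus A a
| der_box_ind a : ITL0_plus A (a ⇒ ◯ a) -> ITL0_plus A (a ⇒ □ a)
| der_dia_ind a : ITL0_plus A (◯ a ⇒ a) -> ITL0_plus A (◇ a ⇒ a)
| der_mp a b : ITL0_plus A (a ⇒ b) -> ITL0_plus A a -> ITL0_plus A b
| der_next a : ITL0_plus A a -> ITL0_plus A (◯ a).

Definition FS_next (V : Type) (a b : form V) : form V :=
  ((◯ a ⇒ ◯ b) ⇒ ◯ (a ⇒ b))%itl.

Definition FS_dia (V : Type) (a b : form V) : form V :=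
  ((◇ a ⇒ □ b) ⇒ □ (a ⇒ b))%itl.

Inductive FS_axiom (V : Type) : form V -> Prop :=
| ax_FS_next a b : FS_axiom (FS_next a b)
| ax_FS_dia a b : FS_axiom (FS_dia a b).

Definition ITL_FS (V : Type) : form V -> Prop := ITL0_plus (@FS_axiom V).

Record dynSystem : Type := DynSystem {
  space :> topologicalType;
  step : space -> space;
  step_continuous : continuous step
}.

Definition open_system (X : dynSystem) : Prop :=
  forall U : set X, open U -> open (@step X @` U).

(* A valuation is determined by its values on the variables. *)
Fixpoint truth (V : Type) (X : dynSystem) (v : V -> set X) (a : form V)
    : set X :=
  match a with
  | Var p => v p
  | Bot => set0
  | And a b => truth v a `&` truth v b
  | Or a b => truth v a `|` truth v b
  | Imp a b => interior (~` truth v a `|` truth v b)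
  | Next a => @step X @^-1` truth v a
  | Dia a => \bigcup_n (iter n (@step X) @^-1` truth v a)
  | Box a => \bigcup_(U in [set U : set X |
               [/\ open U, @step X @` U `<=` U & U `<=` truth v a]]) U
  end.

Definition valid (V : Type) (X : dynSystem) (a : form V) : Prop :=
  forall v : V -> set X, (forall p, open (v p)) -> truth v a = setT.

Definition sound (V : Type) (L : form V -> Prop) (C : dynSystem -> Prop)
    : Prop :=
  forall a, L a -> forall X : dynSystem, C X -> valid X a.

(* Every formula is interpreted by an open set, as required of a valuation. *)
Lemma open_truth (V : Type) (X : dynSystem) (v : V -> set X) (a : form V) :
  (forall p, open (v p)) -> open (truth v a).
Proof.
move=> vo.
have pre (B : set X) : open B -> open (@step X @^-1` B).
  by move: B; apply/continuousP; exact: step_continuous.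
elim: a => //= [|a oa b ob|a oa b ob|a oa b ob|a oa|a oa|a oa].
- exact: open0.
- exact: openI.
- exact: openU.
- exact: open_interior.
- exact: pre.
- apply: bigcup_open => n _; elim: n => [//|n IH].
  suff -> : iter n.+1 (@step X) @^-1` truth v a =
            @step X @^-1` (iter n (@step X) @^-1` truth v a) by exact: pre.
  by apply/seteqP; split=> x /=; rewrite -iterSr.
- by apply: bigcup_open => U [].
Qed.

(* Main.v *)
(** Opens ordered by inclusion form a Heyting algebra, and [Imp] is its
    implication, so every axiom reduces to inclusions between open sets. The
    openness of the map [S] enters only through the Fischer Servi axioms: an
    open [W] witnessing the premise yields the open set [S[W]] for FS_next, and
    the open, [S]-invariant union of all [S^n[W]] for FS_dia. *)

From mathcomp Require Import all_boot.
From mathcomp Require Import all_classical topology.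
Require Import Defs.

Set Implicit Arguments.
Unset Strict Implicit.
Unset Printing Implicit Defensive.

Local Open Scope classical_set_scope.

(** Introduction half of the Heyting adjunction: [W] misses [A] or lands in [B] at each point, and
    openness of [W] lets this pass to the interior. *)
Lemma sub_interior_imp (T : topologicalType) (W A B : set T) :
  open W -> W `&` A `<=` B -> W `<=` interior (~` A `|` B).
Proof.
move=> oW WAB; rewrite -open_subsetE // => x Wx.
by have [Ax|nAx] := pselect (A x); [right; exact: WAB|left].
Qed.

Lemma interior_imp_mp (T : topologicalType) (A B : set T) (x : T) :
  interior (~` A `|` B) x -> A x -> B x.
Proof. by move=> /interior_subset [nAx /nAx|]. Qed.

Lemma interior_imp_setT (T : topologicalType) (A B : set T) :
  interior (~` A `|` B) = setT <-> A `<=` B.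
Proof.
split=> [AB x|AB]; first by apply: interior_imp_mp; rewrite AB.
apply/seteqP; split=> //; apply: sub_interior_imp; first exact: openT.
by rewrite setTI.
Qed.

Section Soundness.
Variables (V : Type) (X : dynSystem) (v : V -> set X).
Hypothesis vo : forall p, open (v p).

Let S := @step X.

(** An arbitrary open [W] below all hypotheses stands in for the meet of the context; assuming [q]
    amounts to replacing [W] by its intersection with the truth set of [q]. *)
Lemma truth_NJ (G : seq pform) (p : pform) (s : nat -> form V) : NJ G p ->
  forall W : set X, open W ->
  (forall q, List.In q G -> W `<=` truth v (psubst s q)) ->
  W `<=` truth v (psubst s p).
Proof.
have ext (H : seq pform) (W : set X) (q : pform) :
    (forall r, List.In r H -> W `<=` truth v (psubst s r)) ->
    forall r, List.In r (q :: H) ->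
    W `&` truth v (psubst s q) `<=` truth v (psubst s r).
  by move=> HW r [<- x []|/HW Wr x [/Wr]].
elim=> {G p} [G p Gp|G p _ IH|G p q _ IHp _ IHq|G p q _ IH|G p q _ IH
  |G p q _ IH|G p q _ IH|G p q r _ IH _ IHp _ IHq|G p q _ IH
  |G p q _ IHpq _ IHp] W oW GW.
- exact: GW.
- by move=> x /(IH W oW GW).
- by move=> x Wx; split; [exact: IHp Wx|exact: IHq Wx].
- by move=> x /(IH W oW GW)[].
- by move=> x /(IH W oW GW)[].
- by move=> x /(IH W oW GW); left.
- by move=> x /(IH W oW GW); right.
- move=> x Wx; have [px|qx] := IH W oW GW x Wx.
  + apply: (IHp (W `&` truth v (psubst s p))); [|exact: ext|by []].
    by apply: openI => //; exact: open_truth.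
  + apply: (IHq (W `&` truth v (psubst s q))); [|exact: ext|by []].
    by apply: openI => //; exact: open_truth.
- apply: sub_interior_imp => //; apply: IH; last exact: ext.
  by apply: openI => //; exact: open_truth.
- move=> x Wx; apply: interior_imp_mp (IHp W oW GW x Wx).
  exact: IHpq Wx.
Qed.

Lemma iter_invariant (U : set X) (n : nat) (x : X) :
  S @` U `<=` U -> U x -> U (iter n S x).
Proof. by move=> SU Ux; elim: n => //= n IH; apply: SU; exists (iter n S x). Qed.

(** The invariant open set witnessing the box contains the whole forward orbit of [x]. *)
Lemma truth_box_iter (a : form V) (n : nat) (x : X) :
  truth v (Box a) x -> truth v a (iter n S x).
Proof. by move=> [U [_ SU Ua] Ux]; apply/Ua/(iter_invariant (U := U)). Qed.

Lemma truth_ITL0_axiom (a : form V) : ITL0_axiom a -> truth v a = setT.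
Proof.
have iffT (A B : set X) : A = B ->
    interior (~` A `|` B) `&` interior (~` B `|` A) = setT.
  by move=> ->; rewrite (interior_imp_setT B B).2 // setIT.
have oS (b : form V) : open (truth v b) by exact: open_truth.
case=> {a} [a [p [s [NJp ->]]]||a b|a b|a b|a b|a b|a b|a|a].
- apply/seteqP; split=> //.
  by apply: (truth_NJ NJp) => //; exact: openT.
- exact/interior_imp_setT.
(* Preimages commute with intersections and unions, so the two sides are convertible. *)
- exact: iffT.
- exact: iffT.
- apply/interior_imp_setT; apply: sub_interior_imp.
    exact: (oS (Next (Imp a b))).
  by move=> x [/interior_imp_mp].
- apply/interior_imp_setT; apply: sub_interior_imp.
    exact: (oS (Box (Imp a b))).
  move=> x [[U [oU SU Uab] Ux] [W [oW SW Wa] Wx]].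
  (* Invariant open sets are closed under binary intersection. *)
  exists (U `&` W) => //; split; first exact: openI.
  + by move=> _ [y [Uy Wy] <-]; split; [apply: SU|apply: SW]; exists y.
  + by move=> y [/Uab /interior_imp_mp + /Wa]; apply.
- apply/interior_imp_setT; apply: sub_interior_imp.
    exact: (oS (Box (Imp a b))).
  move=> x [xab [n _ nxa]]; exists n => //.
  exact: interior_imp_mp (truth_box_iter (a := Imp a b) n xab) nxa.
- apply/interior_imp_setT => x [n _ [nxa|nxb]]; [left|right]; by exists n.
- apply/interior_imp_setT => x [U [oU SU Ua] Ux]; split; first exact: Ua.
  by exists U => //; apply: SU; exists x.
- apply/interior_imp_setT => x [xa|[n _ nxa]]; first by exists 0.
  by exists n.+1 => //=; rewrite -iterS iterSr.
Qed.

Lemma truth_FS_axiom (a : form V) :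
  open_system X -> FS_axiom a -> truth v a = setT.
Proof.
move=> oS [{}a b|{}a b]; apply/interior_imp_setT => x Wx.
- have /(_ (S x)) : S @` interior (~` truth v (Next a) `|` truth v (Next b))
      `<=` truth v (Imp a b).
    apply: sub_interior_imp; first exact/oS/open_interior.
    (* A point of the image is [S y]; having [a] at [S y] is having [Next a] at [y], where the
       premise applies. *)
    by move=> _ [[y Wy <-]]; exact: interior_imp_mp Wy.
  by apply; exists x.
- set W := truth v (Imp (Dia a) (Box b)) in Wx.
  have oW n : open (iter n S @` W).
    elim: n => [|n IH]; first by rewrite image_id; exact: open_interior.
    by have := oS _ IH; rewrite image_comp.
  exists (\bigcup_n (iter n S @` W)); last by exists 0 => //; exists x.
  split; first by apply: bigcup_open => n _; exact: oW.
  + by move=> _ [_ [n _ [y Wy <-]] <-]; exists n.+1 => //; exists y.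
  + move=> _ [n _ [y Wy <-]].
    have := @sub_interior_imp _ _ (truth v a) (truth v b) (oW n); apply.
      (* If [a] holds at the [n]-th iterate of [z], then [z] satisfies [Dia a], hence [Box b], which
         carries [b] forward to that same iterate. *)
      move=> _ [[z Wz <-] za]; apply: truth_box_iter.
      by apply: interior_imp_mp Wz _; exists n.
    by exists y.
Qed.

(** The truth set of [a] is open and, by the premise, invariant, so it is its own witness. *)
Lemma truth_box_ind (a : form V) :
  truth v (Imp a (Next a)) = setT -> truth v (Imp a (Box a)) = setT.
Proof.
move=> /interior_imp_setT aSa; apply/interior_imp_setT => x ax.
exists (truth v a) => //; split=> //; first exact: open_truth.
by move=> _ [y /aSa ay <-].
Qed.

(** The premise pulls [a] back along the orbit, one application of [S] at a time. *)
Lemma truth_dia_ind (a : form V) :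
  truth v (Imp (Next a) a) = setT -> truth v (Imp (Dia a) a) = setT.
Proof.
move=> /interior_imp_setT Saa; apply/interior_imp_setT => x [n _].
by elim: n => //= n IH /Saa.
Qed.

End Soundness.

Theorem theorem5p4 (V : Type) : sound (@ITL_FS V) open_system.
Proof.
move=> a La X oX v vo.
elim: La => {a} [a|a|a _|a _|a b _ + _ aT|a _ /= ->].
- exact: truth_ITL0_axiom.
- exact: truth_FS_axiom.
- exact: truth_box_ind.
- exact: truth_dia_ind.
- move=> /(interior_imp_setT (truth v a) (truth v b)); rewrite aT => bT.
  by apply/seteqP.
- exact: preimage_setT.
Qed.
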